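(* Let $\alpha,\beta,\gamma,\delta\in\mathbb{R}$ with $\alpha+\delta\neq 0$ and $\alpha\gamma=0$, and let $(G_7,g,J)$ be the connected, simply connected three-dimensional Lorentzian Lie group with product structure $J$ whose Lie algebra $\mathfrak{g}$ has a pseudo-orthonormal basis $\{e_1,e_2,e_3\}$ ($e_3$ timelike) with $[e_1,e_2]=-\alpha e_1-\beta e_2-\beta e_3$, $[e_1,e_3]=\alpha e_1+\beta e_2+\beta e_3$, $[e_2,e_3]=\gamma e_1+\delta e_2+\delta e_3$. Let $c\in\mathbb{R}$. Then $(G_7,g,J)$ is a first kind algebraic Ricci soliton associated to the canonical connection $\nabla^0$ with constant $c$ if and only if one of the following holds: (i) $\alpha=\gamma=c=0$, $\beta\neq 0$, $\delta\neq 0$; in particular, $D=0$; (ii) $\beta=\gamma=0$, $\alpha^2+c=0$, $\alpha+\delta\neq 0$; in particular, $De_1=0$, $De_2=0$, $De_3=\alpha^2e_2+\alpha^2e_3$.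
   Context: The left-invariant Lorentzian metric $g$ satisfies $g(e_1,e_1)=g(e_2,e_2)=1$, $g(e_3,e_3)=-1$, $g(e_i,e_j)=0$ for $i\ne j$. All tensors and connections are left-invariant and evaluated on $\mathfrak{g}$. $\nabla$ is the Levi-Civita connection of $g$. The product structure is $Je_1=e_1$, $Je_2=e_2$, $Je_3=-e_3$, and $(\nabla_XJ)Y=\nabla_X(JY)-J(\nabla_XY)$. The canonical connection is $\nabla^0_XY=\nabla_XY-\frac12(\nabla_XJ)(JY)$, with curvature $R^0(X,Y)Z=\nabla^0_X\nabla^0_YZ-\nabla^0_Y\nabla^0_XZ-\nabla^0_{[X,Y]}Z$. Its Ricci tensor is $\rho^0(X,Y)=-g(R^0(X,e_1)Y,e_1)-g(R^0(X,e_2)Y,e_2)+g(R^0(X,e_3)Y,e_3)$ and the Ricci operator $\mathrm{Ric}^0$ is defined by $\rho^0(X,Y)=g(\mathrm{Ric}^0(X),Y)$. First kind algebraic Ricci soliton associated to $\nabla^0$ with constant $c$ means: $\mathrm{Ric}^0=c\,\mathrm{Id}+D$ where $D$ is a derivation of $\mathfrak{g}$, i.e. a linear map with $D[X,Y]=[DX,Y]+[X,DY]$ for all $X,Y\in\mathfrak{g}$. *)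

(* Defs.v *)
From HB Require Import structures.
From mathcomp Require Import all_boot all_order all_algebra.
From mathcomp Require Import reals.

Set Implicit Arguments.
Unset Strict Implicit.
Unset Printing Implicit Defensive.

Import Order.TTheory GRing.Theory Num.Theory.

Local Open Scope ring_scope.

(* Left-invariant tensor fields and connections on a connected, simply        *)
(* connected Lie group are determined by their values on left-invariant       *)
(* vector fields. The geometry below is therefore carried by the Lie algebra: *)
(* a finite-dimensional real vector space V with a bracket br, a metric g and *)
(* connections viewed as maps V -> V -> V, with nabla X Y for nabla_X Y.      *)

Section LeftInvariantGeometry.
Context {R : realType} {V : vectType R}.

Definition lie_bracket (br : V -> V -> V) : Prop :=
  (forall X, br X X = 0) /\
  (forall X Y Z, br X (br Y Z) + br Y (br Z X) + br Z (br X Y) = 0).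

Definition pseudo_orthonormal_basis (g : V -> V -> R) (e1 e2 e3 : V) : Prop :=
  [/\ basis_of fullv [:: e1; e2; e3],
      [/\ g e1 e1 = 1, g e2 e2 = 1 & g e3 e3 = -1],
      [/\ g e1 e2 = 0, g e1 e3 = 0 & g e2 e3 = 0] &
      [/\ g e2 e1 = 0, g e3 e1 = 0 & g e3 e2 = 0]].

(* For left-invariant X, Y, Z the function g(Y, Z) is constant, so that       *)
(* X(g(Y, Z)) = 0 in the metric compatibility condition.                      *)
Definition levi_civita (br : V -> V -> V) (g : V -> V -> R)
    (nabla : V -> V -> V) : Prop :=
  (forall X Y, nabla X Y - nabla Y X = br X Y) /\
  (forall X Y Z, g (nabla X Y) Z + g Y (nabla X Z) = 0).

Definition product_structure (J : V -> V) (e1 e2 e3 : V) : Prop :=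
  [/\ J e1 = e1, J e2 = e2 & J e3 = - e3].

Definition nablaJ (nabla : V -> V -> V) (J : V -> V) (X Y : V) : V :=
  nabla X (J Y) - J (nabla X Y).

Definition canonical_connection (nabla : V -> V -> V) (J : V -> V)
    (X Y : V) : V :=
  nabla X Y - 2^-1 *: nablaJ nabla J X (J Y).

Definition curvature (br nabla : V -> V -> V) (X Y Z : V) : V :=
  nabla X (nabla Y Z) - nabla Y (nabla X Z) - nabla (br X Y) Z.

Definition ricci_tensor (br : V -> V -> V) (g : V -> V -> R)
    (nabla : V -> V -> V) (e1 e2 e3 X Y : V) : R :=
  - g (curvature br nabla X e1 Y) e1
  - g (curvature br nabla X e2 Y) e2
  + g (curvature br nabla X e3 Y) e3.

Definition ricci_operator (g rho : V -> V -> R) (Ric : V -> V) : Prop :=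
  forall X Y, rho X Y = g (Ric X) Y.

Definition derivation (br : V -> V -> V) (D : 'End(V)) : Prop :=
  forall X Y, D (br X Y) = br (D X) Y + br X (D Y).

Definition soliton_derivation (br : V -> V -> V) (Ric : 'End(V)) (c : R)
    (D : 'End(V)) : Prop :=
  derivation br D /\ Ric = c *: \1%VF + D.

Definition algebraic_ricci_soliton (br : V -> V -> V) (Ric : 'End(V))
    (c : R) : Prop :=
  exists D : 'End(V), soliton_derivation br Ric c D.

Definition g7_brackets (br : V -> V -> V) (e1 e2 e3 : V)
    (alpha beta gamma delta : R) : Prop :=
  [/\ br e1 e2 = - alpha *: e1 - beta *: e2 - beta *: e3,
      br e1 e3 = alpha *: e1 + beta *: e2 + beta *: e3 &
      br e2 e3 = gamma *: e1 + delta *: e2 + delta *: e3].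

End LeftInvariantGeometry.

(* Main.v *)
(** The endomorphism J is parallel for the canonical connection, so on the
    frame [nabla^0] acts as an infinitesimal rotation of the plane (e1, e2)
    with angle form [omega X = g (nabla_X e1) e2], and kills e3.  Rotations of
    a plane commute, hence the curvature is [- omega [X, Y]] times the rotation
    generator and [Ric^0 X = omega [X, e2] e1 - omega [X, e1] e2].  Koszul's
    formula gives [omega = (alpha, beta, gamma / 2 - beta)] on the frame, and
    the soliton condition becomes a polynomial system in the structure
    constants, which forces [(alpha + delta) (k + c) = 0] with
    [k = alpha^2 + beta gamma / 2], i.e. [c = - k]. *)

Require Import Defs.
From mathcomp Require Import all_boot all_order all_algebra.
From mathcomp Require Import reals.
From mathcomp Require Import ring lra.

Set Implicit Arguments.
Unset Strict Implicit.
Unset Printing Implicit Defensive.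

Import Order.TTheory GRing.Theory Num.Theory.

Local Open Scope ring_scope.

(** * Extension by linearity from a three-vector basis *)

Definition linear_expand := (linearDl, linearDr, linearBl, linearBr,
  linearNl, linearNr, linearZl_LR, linearZr_LR).

Lemma basis3_ind (F : fieldType) (V : vectType F) (e1 e2 e3 : V)
    (P : V -> Prop) :
  basis_of fullv [:: e1; e2; e3] ->
  (forall a X Y, P X -> P Y -> P (a *: X + Y)) ->
  P e1 -> P e2 -> P e3 -> forall X, P X.
Proof.
move=> eB PL P1 P2 P3 X.
(* Zero is reached as [-1 *: e1 + e1]; it terminates the coordinate sum below. *)
have P0 : P 0 by have := PL (-1) _ _ P1 P1; rewrite scaleN1r addNr.
rewrite (@coord_basis _ _ _ _ [tuple e1; e2; e3] X eB (memvf X)).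
rewrite !big_ord_recl big_ord0 /=.
by apply/(PL _ _ _ P1)/(PL _ _ _ P2)/PL.
Qed.

(** * Derivations of an alternating bracket *)

Section BracketDerivation.
Context {R : realType} {V : vectType R} (br : {bilinear V -> V -> V}).
Hypothesis br_alt : forall X, br X X = 0.

Lemma bracket_anticomm X Y : br Y X = - br X Y.
Proof.
apply/eqP; rewrite -addr_eq0 addrC; apply/eqP.
have := br_alt (X + Y); rewrite !linear_expand !br_alt.
by rewrite addr0 add0r addrC.
Qed.

(** The Leibniz defect of [D] is bilinear and alternating in [X] and [Y], so its vanishing can be
    tested on pairs of distinct basis vectors. *)
Lemma derivation_on_basis (D : 'End(V)) (e1 e2 e3 : V) :
  basis_of fullv [:: e1; e2; e3] ->
  D (br e1 e2) = br (D e1) e2 + br e1 (D e2) ->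
  D (br e1 e3) = br (D e1) e3 + br e1 (D e3) ->
  D (br e2 e3) = br (D e2) e3 + br e2 (D e3) ->
  derivation br D.
Proof.
move=> eB D12 D13 D23.
pose L X Y := D (br X Y) = br (D X) Y + br X (D Y).
have LC X Y : L X Y -> L Y X.
  rewrite /L => DXY; rewrite (bracket_anticomm X Y) linearN /= DXY.
  by rewrite (bracket_anticomm X) (bracket_anticomm (D X)) opprD addrC.
have LD Y a X X' : L X Y -> L X' Y -> L (a *: X + X') Y.
  rewrite /L => LX LX'.
  by rewrite linearPl !linearP /= LX LX' !linearPl scalerDr addrACA.
have LL X : L X X.
  by rewrite /L br_alt linear0 [br X (D X)]bracket_anticomm subrr.
have LE X : [/\ L X e1, L X e2 & L X e3].
  by split; apply: (basis3_ind eB (P := L^~ _)); auto.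
move=> X Y; have [L1 L2 L3] := LE X; apply: (LC Y X).
by apply: (basis3_ind eB (P := L^~ X)) => [a Z Z'|||];
  [exact: LD | exact: LC | exact: LC | exact: LC].
Qed.

End BracketDerivation.

(** * Pseudo-orthonormal frames *)

Section Frame.
Context {R : realType} {V : vectType R} (g : {biscalar V}) (e1 e2 e3 : V).
Hypothesis gB : pseudo_orthonormal_basis g e1 e2 e3.

(** A [biscalar] form carries no symmetry by itself; here it is inherited from the diagonal Gram
    matrix of the frame. *)
Lemma metric_sym X Y : g X Y = g Y X.
Proof.
have [eB [g11 g22 g33] [g12 g13 g23] [g21 g31 g32]] := gB.
have sym_frame Z : g Z e1 = g e1 Z -> g Z e2 = g e2 Z -> g Z e3 = g e3 Z ->
    forall W, g Z W = g W Z.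
  move=> Z1 Z2 Z3; apply: (basis3_ind eB) => // a W W' ZW ZW'.
  by rewrite linearPl linearPr ZW ZW'.
by apply: (sym_frame X); apply/esym/(sym_frame _);
  rewrite ?g12 ?g13 ?g21 ?g23 ?g31 ?g32.
Qed.

Lemma frame_decomp X : X = g X e1 *: e1 + g X e2 *: e2 - g X e3 *: e3.
Proof.
have [eB [g11 g22 g33] [g12 g13 g23] [g21 g31 g32]] := gB.
apply: (basis3_ind eB
  (P := fun X => X = g X e1 *: e1 + g X e2 *: e2 - g X e3 *: e3)) X.
- move=> a X Y EX EY; rewrite !linearPl /= !scalerDl -!scalerA.
  by rewrite [X in X - _]addrACA -scalerDr opprD addrACA -scalerBr -EX -EY.
- by rewrite g11 g12 g13 scale1r !scale0r addr0 subr0.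
- by rewrite g21 g22 g23 scale1r !scale0r add0r subr0.
- by rewrite g31 g32 g33 !scale0r !add0r scaleN1r opprK.
Qed.

Lemma frame_ext X Y :
  g X e1 = g Y e1 -> g X e2 = g Y e2 -> g X e3 = g Y e3 -> X = Y.
Proof. by move=> E1 E2 E3; rewrite (frame_decomp X) E1 E2 E3 -frame_decomp. Qed.

(** * The canonical connection, its curvature and its Ricci operator *)

Section Connection.
Context (br nabla : {bilinear V -> V -> V}) (J : 'End(V)).
Hypothesis h_nabla : levi_civita br g nabla.
Hypothesis h_J : product_structure J e1 e2 e3.

(** Torsion-freeness turns the brackets into differences of [nabla]; three instances of metric
    compatibility then cancel all terms but one. No derivatives of [g] occur, by left-invariance. *)
Lemma koszul X Y Z :
  2 * g (nabla X Y) Z = g (br X Y) Z - g (br Y Z) X + g (br Z X) Y.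
Proof.
have [T M] := h_nabla.
rewrite -!T !linearBl.
have := M X Y Z; have := M Y X Z; have := M Z X Y.
rewrite !(metric_sym _ (nabla _ _)); lra.
Qed.

Let omega X := g (nabla X e1) e2.
Local Notation nabla0 := (canonical_connection nabla J).

Lemma canonical_connectionZ X a Y : nabla0 X (a *: Y) = a *: nabla0 X Y.
Proof.
have JZ b Z : J (b *: Z) = b *: J Z by exact: linearZ.
rewrite /canonical_connection /nablaJ !(JZ, linearZr_LR) /=.
by rewrite -scalerBr [2^-1 *: _]scalerA mulrC -scalerA -scalerBr.
Qed.

Lemma product_structureK : involutive J.
Proof.
have [J1 J2 J3] := h_J; have [eB _ _ _] := gB.
apply: (basis3_ind eB) => [a X Y JX JY|||];
  rewrite ?J1 ?J2 ?J3 ?linearN /= ?J3 ?opprK //.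
by rewrite !linearP /= JX JY.
Qed.

(** This form shows [nabla0] as the average of [nabla] and its conjugate by [J]. It therefore
    commutes with [J] and preserves the eigenspaces of [J]: the plane ([e1], [e2]) and the line of
    [e3]. *)
Lemma canonical_connectionE X Y :
  nabla0 X Y = 2^-1 *: (nabla X Y + J (nabla X (J Y))).
Proof.
rewrite /canonical_connection /nablaJ product_structureK.
rewrite -[X in X - _](scalerK (a := 2)) ?pnatr_eq0 // -scalerBr; congr (_ *: _).
by rewrite opprB scaler_nat mulr2n addrA addrAC addrK.
Qed.

Lemma product_structure_coord X :
  [/\ g (J X) e1 = g X e1, g (J X) e2 = g X e2 & g (J X) e3 = - g X e3].
Proof.
have [J1 J2 J3] := h_J.
have [eB [g11 g22 g33] [g12 g13 g23] [g21 g31 g32]] := gB.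
rewrite {1 3 5}(frame_decomp X) !(linearB, linearD, linearZ) /= J1 J2 J3.
rewrite !linear_expand /= g11 g12 g13 g21 g22 g23 g31 g32 g33.
by split; ring.
Qed.

Lemma metric_nabla_diag X Y : g (nabla X Y) Y = 0.
Proof.
have [_ M] := h_nabla; have := M X Y Y; rewrite metric_sym; lra.
Qed.

(** Averaging removes the [e3] component of [nabla X e1]; its [e1] component vanishes because
    [g e1 e1] is constant. *)
Lemma canonical_connection_e1 X : nabla0 X e1 = omega X *: e2.
Proof.
have [J1 J2 J3] := h_J.
have [eB [g11 g22 g33] [g12 g13 g23] [g21 g31 g32]] := gB.
have [N1 N2 N3] := product_structure_coord (nabla X e1).
have Nd := metric_nabla_diag X e1.
rewrite canonical_connectionE J1; apply: frame_ext;
  rewrite !linear_expand /= ?N1 ?N2 ?N3 /omega ?g21 ?g22 ?g23; lra.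
Qed.

Lemma canonical_connection_e2 X : nabla0 X e2 = - omega X *: e1.
Proof.
have [J1 J2 J3] := h_J; have [_ M] := h_nabla.
have [eB [g11 g22 g33] [g12 g13 g23] [g21 g31 g32]] := gB.
have [N1 N2 N3] := product_structure_coord (nabla X e2).
have Nd := metric_nabla_diag X e2.
have := M X e1 e2; rewrite (metric_sym e1) => M12.
rewrite canonical_connectionE J2; apply: frame_ext;
  rewrite !linear_expand /= ?N1 ?N2 ?N3 /omega ?g11 ?g12 ?g13; lra.
Qed.

(** Averaging leaves only the [e3] component, which vanishes because [g e3 e3] is constant. *)
Lemma canonical_connection_e3 X : nabla0 X e3 = 0.
Proof.
have [J1 J2 J3] := h_J.
have [N1 N2 N3] := product_structure_coord (nabla X e3).
have Nd := metric_nabla_diag X e3.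
rewrite canonical_connectionE J3 linearNr linearN; apply: frame_ext;
  rewrite !linear_expand /= ?N1 ?N2 ?N3 linear0l; lra.
Qed.

Lemma curvature_e1 X Y :
  curvature br nabla0 X Y e1 = - omega (br X Y) *: e2.
Proof.
rewrite /curvature !canonical_connection_e1 !canonical_connectionZ.
rewrite !canonical_connection_e2 !scalerA !mulrN [omega Y * _]mulrC subrr.
by rewrite sub0r scaleNr.
Qed.

Lemma curvature_e2 X Y :
  curvature br nabla0 X Y e2 = omega (br X Y) *: e1.
Proof.
rewrite /curvature !canonical_connection_e2 !canonical_connectionZ.
rewrite !canonical_connection_e1 !scalerA !mulNr [omega Y * _]mulrC subrr.
by rewrite sub0r scaleNr opprK.
Qed.

Lemma curvature_e3 X Y : curvature br nabla0 X Y e3 = 0.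
Proof.
rewrite /curvature !canonical_connection_e3.
(* Writing zero as [0 *: e3] lets homogeneity alone evaluate [nabla0] there. *)
by rewrite -(scale0r e3) !canonical_connectionZ !scale0r !subr0.
Qed.

(** The curvature takes values in the plane ([e1], [e2]), so the timelike term of the trace is zero;
    pairing with the frame then determines [Ric X]. *)
Lemma ricci_operatorE (Ric : V -> V) X :
  ricci_operator g (ricci_tensor br g nabla0 e1 e2 e3) Ric ->
  Ric X = omega (br X e2) *: e1 - omega (br X e1) *: e2.
Proof.
have [eB [g11 g22 g33] [g12 g13 g23] [g21 g31 g32]] := gB.
move=> h_Ric; apply: frame_ext; rewrite -h_Ric /ricci_tensor
  ?curvature_e1 ?curvature_e2 ?curvature_e3 !linear_expand /=
  ?linear0l ?g11 ?g12 ?g13 ?g21 ?g22 ?g23; ring.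
Qed.

End Connection.
End Frame.

(** * The Lie algebra of [G_7] *)

Section G7.
Context {R : realType} {V : vectType R} (g : {biscalar V}) (e1 e2 e3 : V).
Context (br : {bilinear V -> V -> V}) (alpha beta gamma delta : R).
Hypothesis gB : pseudo_orthonormal_basis g e1 e2 e3.
Hypothesis br_alt : forall X, br X X = 0.
Hypothesis h_br : g7_brackets br e1 e2 e3 alpha beta gamma delta.

Lemma g7_connection_form (nabla : {bilinear V -> V -> V}) :
  levi_civita br g nabla ->
  [/\ g (nabla e1 e1) e2 = alpha, g (nabla e2 e1) e2 = beta &
      g (nabla e3 e1) e2 = gamma / 2 - beta].
Proof.
have [b12 b13 b23] := h_br.
have [eB [g11 g22 g33] [g12 g13 g23] [g21 g31 g32]] := gB.
move=> h_nabla.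
have := koszul gB h_nabla e1 e1 e2; have := koszul gB h_nabla e2 e1 e2.
have := koszul gB h_nabla e3 e1 e2.
rewrite (bracket_anticomm br_alt e1 e2) (bracket_anticomm br_alt e1 e3) !br_alt.
rewrite b12 b13 b23 !linear_expand /= !linear0l.
rewrite g11 g12 g13 g21 g22 g23 g31 g32 g33 => K3 K2 K1.
by split; lra.
Qed.

(** As [br e1 e3 = - br e1 e2], the single value [- k] of [omega] at [br e1 e2] supplies every entry
    but the [e1] coefficient of [Ric e3], which comes from [br e2 e3]. *)
Lemma g7_ricci (nabla : {bilinear V -> V -> V}) (J Ric : 'End(V)) :
  levi_civita br g nabla -> product_structure J e1 e2 e3 ->
  ricci_operator g
    (ricci_tensor br g (canonical_connection nabla J) e1 e2 e3) Ric ->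
  let k := alpha ^+ 2 + beta * gamma / 2 in
  [/\ Ric e1 = - k *: e1, Ric e2 = - k *: e2 &
      Ric e3 = - (gamma * (alpha + delta / 2)) *: e1 + k *: e2].
Proof.
have [b12 b13 b23] := h_br => h_nabla h_J h_Ric k.
have [w1 w2 w3] := g7_connection_form h_nabla.
rewrite !(ricci_operatorE gB h_nabla h_J _ h_Ric) !br_alt.
rewrite (bracket_anticomm br_alt e1 e2) (bracket_anticomm br_alt e1 e3).
rewrite (bracket_anticomm br_alt e2 e3).
rewrite b12 b13 b23 !linear_expand /= !linear0l w1 w2 w3 !scale0r.
split; rewrite ?subr0 ?sub0r -?scaleNr;
  (congr (_ *: _ + _ *: _) || congr (_ *: _));
  by rewrite /k; field.
Qed.

(** The shape of [D] is that of [Ric - c Id], with [l] the [e1] coefficient of [Ric e3]. The nine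
    coordinates of the Leibniz defect reduce to four: its [e2] and [e3] coefficients agree on each
    pair, and the pairs ([e1], [e2]) and ([e1], [e3]) give opposite defects. *)
Lemma g7_derivationP (D : 'End(V)) (k l c : R) :
  D e1 = - (k + c) *: e1 -> D e2 = - (k + c) *: e2 ->
  D e3 = l *: e1 + k *: e2 - c *: e3 ->
  derivation br D <->
  [/\ beta * l = - (alpha * (k + c)), beta * l = delta * (k + c),
      beta * (c + 2 * k) = 0 & (alpha - delta) * l = gamma * c].
Proof.
move=> D1 D2 D3; have [b12 b13 b23] := h_br.
have [eB [g11 g22 g33] [g12 g13 g23] [g21 g31 g32]] := gB.
have gE := (g11, g22, g33, (g12, g13, g23), (g21, g31, g32)).
have b21 := bracket_anticomm br_alt e1 e2.
have b31 := bracket_anticomm br_alt e1 e3.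
have b32 := bracket_anticomm br_alt e2 e3.
have DE := (D1, D2, D3).
have brE := (b21, b31, b32, br_alt, (b12, b13, b23)).
(* Pairing with [e3] gives minus the [e3] coefficient of the defect, whence the opposite signs in
   the last two entries of each triple. *)
pose dev X Y i := g (br (D X) Y + br X (D Y)) i - g (D (br X Y)) i.
have dev12 : [/\ dev e1 e2 e1 = beta * l + alpha * (k + c),
    dev e1 e2 e2 = beta * (c + 2 * k) & dev e1 e2 e3 = - (beta * (c + 2 * k))].
  rewrite /dev !DE !linear_expand /= !brE.
  rewrite !(linearB, linearD, linearN, linearZ) /=.
  by rewrite !DE !linear_expand /= !gE; split; ring.
have dev13 : [/\ dev e1 e3 e1 = - (beta * l + alpha * (k + c)),
    dev e1 e3 e2 = - (beta * (c + 2 * k)) & dev e1 e3 e3 = beta * (c + 2 * k)].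
  rewrite /dev !DE !linear_expand /= !brE.
  rewrite !(linearB, linearD, linearN, linearZ) /=.
  by rewrite !DE !linear_expand /= ?linear0l !gE; split; ring.
have dev23 : [/\ dev e2 e3 e1 = (alpha - delta) * l - gamma * c,
    dev e2 e3 e2 = beta * l - delta * (k + c) &
    dev e2 e3 e3 = - (beta * l - delta * (k + c))].
  rewrite /dev !DE !linear_expand /= !brE.
  rewrite !(linearB, linearD, linearN, linearZ) /=.
  by rewrite !DE !linear_expand /= ?linear0l !gE; split; ring.
split=> [der | [h1 h2 h3 h4]].
  have dev0 X Y i : dev X Y i = 0 by rewrite /dev der subrr.
  move: dev12 dev23; rewrite !dev0 => -[h1 h3 _] [h4 h2 _].
  by split; lra.
have devP X Y : dev X Y e1 = 0 -> dev X Y e2 = 0 -> dev X Y e3 = 0 ->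
    D (br X Y) = br (D X) Y + br X (D Y).
  by move=> d1 d2 d3; apply/esym/(frame_ext gB); apply/subr0_eq.
case: dev12 dev13 dev23 => [u1 u2 u3] [v1 v2 v3] [w1 w2 w3].
by apply: (derivation_on_basis br_alt eB); apply: devP;
  rewrite ?u1 ?u2 ?u3 ?v1 ?v2 ?v3 ?w1 ?w2 ?w3; lra.
Qed.

End G7.

(** * Solving the polynomial system *)

Theorem theorem3p22 (R : realType) (V : vectType R)
    (br : {bilinear V -> V -> V}) (g : {biscalar V}) (J : 'End(V))
    (nabla : {bilinear V -> V -> V}) (Ric0 : 'End(V)) (e1 e2 e3 : V)
    (alpha beta gamma delta c : R)
    (h_ad : alpha + delta != 0) (h_ag : alpha * gamma = 0)
    (h_lie : lie_bracket br)
    (h_basis : pseudo_orthonormal_basis g e1 e2 e3)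
    (h_br : g7_brackets br e1 e2 e3 alpha beta gamma delta)
    (h_J : product_structure J e1 e2 e3)
    (h_nabla : levi_civita br g nabla)
    (h_Ric0 : ricci_operator g
       (ricci_tensor br g (canonical_connection nabla J) e1 e2 e3) Ric0) :
  let case_i :=
    [/\ alpha = 0, gamma = 0, c = 0, beta != 0 & delta != 0] in
  let case_ii :=
    [/\ beta = 0, gamma = 0, alpha ^+ 2 + c = 0 & alpha + delta != 0] in
  [/\ algebraic_ricci_soliton br Ric0 c <-> case_i \/ case_ii,
      case_i -> forall D : 'End(V), soliton_derivation br Ric0 c D -> D = 0 &
      case_ii -> forall D : 'End(V), soliton_derivation br Ric0 c D ->
        [/\ D e1 = 0, D e2 = 0 &
            D e3 = alpha ^+ 2 *: e2 + alpha ^+ 2 *: e3]].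
Proof.
move=> case_i case_ii; have [br_alt _] := h_lie; have [eB _ _ _] := h_basis.
have [] := g7_ricci h_basis br_alt h_br h_nabla h_J h_Ric0.
set k := _ + _ => Ric1 Ric2 Ric3.
(* The constant [c] leaves [D0] as the only candidate derivation. *)
pose D0 := Ric0 - c *: \1%VF.
have D0P D : soliton_derivation br Ric0 c D <-> D = D0 /\ derivation br D0.
  rewrite /D0; split=> [[der ->] | [-> der]].
    by rewrite addrAC subrr add0r.
  by split=> //; rewrite addrC subrK.
have D0E X : D0 X = Ric0 X - c *: X.
  by rewrite add_lfunE opp_lfunE scale_lfunE id_lfunE.
have D1 : D0 e1 = - (k + c) *: e1 by rewrite D0E Ric1 -scalerBl -opprD.
have D2 : D0 e2 = - (k + c) *: e2 by rewrite D0E Ric2 -scalerBl -opprD.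
have D3 : D0 e3 = - (gamma * (alpha + delta / 2)) *: e1 + k *: e2 - c *: e3.
  by rewrite D0E Ric3.
have derP := g7_derivationP h_basis br_alt h_br D1 D2 D3.
split.
- split=> [[D /D0P [_ /derP [h1 h2 h3 h4]]] | cases].
    have kc : c = - k.
      apply/eqP; rewrite -addr_eq0 addrC.
      (* The two expressions for [beta * l] in [h1] and [h2] are equated. *)
      have /eqP : (alpha + delta) * (k + c) = 0 by lra.
      by rewrite mulf_eq0 (negbTE h_ad).
    have [a0 | aN0] := eqVneq alpha 0.
      have dN0 : delta != 0 by move: h_ad; rewrite a0 add0r.
      have k0 : k = 0.
        (* With [alpha = 0] and [k + c = 0], [h1] reads [beta * l = 0], where
           [l = - gamma * delta / 2]. *)
        have /eqP : beta * gamma * delta = 0 by move: h1; rewrite kc a0; lra.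
        rewrite mulf_eq0 (negbTE dN0) orbF => /eqP bg0.
        by rewrite /k a0 bg0; ring.
      have c0 : c = 0 by rewrite kc k0 oppr0.
      have g0 : gamma = 0.
        have /eqP : gamma * delta ^+ 2 = 0 by move: h4; rewrite a0 c0; lra.
        by rewrite mulf_eq0 expf_eq0 (negbTE dN0) orbF => /eqP.
      (* The overlap [alpha = beta = 0] belongs to the second case, with [c = 0]. *)
      have [b0 | bN0] := eqVneq beta 0; last by left.
      by right; split=> //; rewrite a0 c0; ring.
    have g0 : gamma = 0.
      by move/eqP: h_ag; rewrite mulf_eq0 (negbTE aN0) => /eqP.
    have kE : k = alpha ^+ 2 by rewrite /k g0; ring.
    have b0 : beta = 0.
      (* Here [c + 2 * k = k = alpha ^+ 2] in [h3]. *)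
      have /eqP : beta * alpha ^+ 2 = 0 by move: h3; rewrite kc kE; lra.
      by rewrite mulf_eq0 expf_eq0 (negbTE aN0) orbF => /eqP.
    by right; split=> //; rewrite kc kE addrN.
  exists D0; apply/D0P; split=> //; apply/derP.
  rewrite /k; case: cases => [[-> -> -> _ _] | [-> -> ac _]].
    by split; ring.
  by have -> : c = - alpha ^+ 2 by [lra]; split; ring.
- move=> [a0 g0 c0 _ _] D /D0P[-> _]; apply/lfunP.
  have k0 : k = 0 by rewrite /k a0 g0; ring.
  apply: (basis3_ind eB) => [a X Y D0X D0Y|||].
  + by rewrite !linearP /= D0X D0Y.
  + by rewrite D1 k0 c0 addr0 oppr0 scale0r zero_lfunE.
  + by rewrite D2 k0 c0 addr0 oppr0 scale0r zero_lfunE.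
  + by rewrite D3 k0 c0 g0 mul0r oppr0 !scale0r addr0 subr0 zero_lfunE.
- move=> [b0 g0 ac _] D /D0P[-> _]; rewrite D1 D2 D3 g0.
  have kE : k = alpha ^+ 2 by rewrite /k b0; ring.
  (* Substituting [k = alpha ^+ 2] makes [k + c] vanish, and [- c = alpha ^+ 2] gives the [e3]
     coefficient. *)
  rewrite kE ac mul0r !oppr0 !scale0r add0r -scaleNr.
  by split=> //; congr (_ + _ *: _); lra.
Qed.
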